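(* Let $k \ge 1$ be an integer. (i) For all integers $n \ge k$ and $1 \le p \le \min\{k, n - k\}$, \[\chi\bigl(J(n, k)^p\bigr) \ge 1 + \frac{\sum_{i = 1}^p \binom{k}{i} \binom{n - k}{i}}{-\min\limits_{1 \le j \le k}\left\{\sum_{i = 1}^p \mathcal{E}_i(j; n, k)\right\}}.\] (ii) For all integers $n > 2k$ and $1 \le p \le \left\lceil\frac{k - 1}{n - 2k}\right\rceil + 1$, \[\chi\bigl(K(n, k)^p\bigr) \ge 1 + \frac{\sum_{i \in \delta_{n,k}^{-1}([p])} \binom{k}{i} \binom{n - k}{i}}{-\min\limits_{1 \le j \le k}\left\{\sum_{i \in \delta_{n,k}^{-1}([p])} \mathcal{E}_i(j; n, k)\right\}}.\]
   Context: $\chi(G)$ is the chromatic number; $[p]=\{1,\dots,p\}$. The Johnson graph $J(n,k)$ ($n\ge k\ge 1$) has as vertices the $k$-subsets of $\{1,\dots,n\}$, with $A,B$ adjacent iff $|A\cap B|=k-1$; its diameter is $\min\{k,n-k\}$. The Kneser graph $K(n,k)$ ($n\ge 2k$) has the same vertex set, with $A,B$ adjacent iff $A\cap B=\emptyset$; for $n>2k$ its diameter is $\lceil (k-1)/(n-2k)\rceil+1$. For a graph $G$ and $p\ge1$, $G^p$ has the same vertex set, two distinct vertices being adjacent iff their distance in $G$ is at most $p$. For $0\le i\le k$, the Eberlein polynomial is $\mathcal{E}_i(x; n, k) = \sum_{t = 0}^i (-1)^t \binom{x}{t} \binom{k - x}{i - t} \binom{n - k - x}{i - t}$. For $n>2k$,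 $\delta_{n,k}:\{0,1,\dots,k\}\to\mathbb{Z}_{\ge0}$ is $\delta_{n,k}(i) = \min\left\{2\left\lceil\frac{i}{n - 2k}\right\rceil,\, 2\left\lceil\frac{k - i}{n - 2k}\right\rceil + 1\right\}$, and $\delta_{n,k}^{-1}([p])=\{i\in\{0,\dots,k\}: 1\le \delta_{n,k}(i)\le p\}$. Convention: $\binom{a}{b} = 0$ whenever $a < b$. *)

(* Defs.v *)
From HB Require Import structures.
From mathcomp Require Import all_boot all_order all_algebra.

Set Implicit Arguments.
Unset Strict Implicit.
Unset Printing Implicit Defensive.

Import Order.TTheory GRing.Theory Num.Theory.

Section Graph.
Variables (T : finType) (e : rel T).

Definition walk (m : nat) (x y : T) : bool :=
  [exists s : m.-tuple T, path e x s && (last x s == y)].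

(* A shortest walk has fewer than #|T| edges, so for connected x and y this is
   the minimum over all walks; otherwise the value is the default #|T|, and
   [gpower] tests connectedness separately. *)
Definition gdist (x y : T) : nat :=
  \big[minn/#|T|]_(m < #|T| | walk m x y) m.

Definition gpower (p : nat) : rel T :=
  fun x y => [&& x != y, connect e x y & gdist x y <= p].

Definition colorable (c : nat) : bool :=
  [exists f : {ffun T -> 'I_c}, [forall x, forall y, e x y ==> (f x != f y)]].

(* A loopless graph is #|T|-colorable, so the default value and the bound on
   the range are harmless: see [chi_colorable] and [chi_min]. *)
Definition chi : nat :=
  \big[minn/#|T|]_(c < #|T|.+1 | colorable c) c.

Lemma bigminn_le N d (P : pred nat) m : m < N -> P m ->
  \big[minn/d]_(i < N | P i) (i : nat) <= m.
Proof.
move=> ltmN Pm; have := mem_index_enum (Ordinal ltmN).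
elim: (index_enum _) => // i r IHr; rewrite inE big_cons.
case/orP=> [/eqP <- /= | /IHr le_r]; first by rewrite Pm geq_minl.
by case: ifP => // _; rewrite geq_min le_r orbT.
Qed.

Lemma bigminn_mem N d (P : pred nat) m : m < N -> P m -> N <= d.+1 ->
  P (\big[minn/d]_(i < N | P i) (i : nat)).
Proof.
move=> ltmN Pm leNd; have := bigminn_le d ltmN Pm.
set M := \big[_/_]_(_ < _ | _) _ => leMm.
have : P M \/ M = d.
  rewrite /M; elim/big_ind: _ => [|a b Pa Pb|i Pi]; [by right | | by left].
  by rewrite /minn; case: ifP.
case=> // Md; have -> // : M = m.
by apply/eqP; rewrite eqn_leq leMm Md -ltnS (leq_trans ltmN).
Qed.

Lemma gdist_min m x y s :
  path e x s -> last x s = y -> size s = m -> gdist x y <= m.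
Proof.
move=> es <-; case/shortenP: es => s' es' us' sub' szs.
have sz' : size s' < #|T|.
  by rewrite -[(size s').+1]/(size (x :: s')) -(card_uniqP us') max_card.
apply: leq_trans (_ : size s' <= m); last first.
  by rewrite -szs; apply: uniq_leq_size => //; case/andP: us'.
apply: (@bigminn_le _ _ (fun m => walk m x (last x s')) _) => //.
by apply/existsP; exists (in_tuple s'); rewrite es' eqxx.
Qed.

Lemma gdist_walk x y : connect e x y -> walk (gdist x y) x y.
Proof.
case/connectP=> s0 es0 ->; case/shortenP: es0 => s es us _.
have szs : size s < #|T|.
  by rewrite -[(size s).+1]/(size (x :: s)) -(card_uniqP us) max_card.
apply: (@bigminn_mem _ _ (fun m => walk m x (last x s)) _ szs) => //.
by apply/existsP; exists (in_tuple s); rewrite es eqxx.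
Qed.

Lemma chi_colorable : irreflexive e -> colorable chi.
Proof.
move=> irr; apply: (@bigminn_mem _ _ colorable _ (ltnSn #|T|)) => //.
apply/existsP; exists [ffun x => enum_rank x].
apply/forallP=> x; apply/forallP=> y; apply/implyP=> exy; rewrite !ffunE.
by apply: contraTneq exy => /enum_rank_inj->; rewrite irr.
Qed.

Lemma chi_min c : irreflexive e -> colorable c -> chi <= c.
Proof.
move=> irr colc; case: (leqP c #|T|) => lecT.
  exact: (@bigminn_le _ _ colorable _).
apply: leq_trans (ltnW lecT); apply: (@bigminn_le _ _ colorable _) => //.
apply/existsP; exists [ffun x => enum_rank x].
apply/forallP=> x; apply/forallP=> y; apply/implyP=> exy; rewrite !ffunE.
by apply: contraTneq exy => /enum_rank_inj->; rewrite irr.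
Qed.

End Graph.

Definition ksubset (n k : nat) : finType := {A : {set 'I_n} | #|A| == k}.

Definition johnson (n k : nat) : rel (ksubset n k) :=
  fun A B => #|val A :&: val B| == k.-1.

Definition kneser (n k : nat) : rel (ksubset n k) :=
  fun A B => [disjoint val A & val B].

Local Open Scope ring_scope.

(* The top argument may be negative (n - k - x below, when x > n - k), in
   which case the value is 0 even for b = 0; truncated subtraction on nat
   would give 1 there. *)
Definition binZ (a : int) (b : nat) : int :=
  if a < b%:Z then 0 else ('C(`|a|%N, b))%:Z.

Definition eberlein (i x n k : nat) : int :=
  \sum_(0 <= t < i.+1)
     (-1) ^+ t * binZ x%:Z t * binZ (k%:Z - x%:Z) (i - t)
              * binZ (n%:Z - k%:Z - x%:Z) (i - t).

Definition ceil_ratio (a b : nat) : nat :=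
  `|Num.ceil (a%:R / b%:R : rat)|%N.

Definition delta (n k i : nat) : nat :=
  minn (2 * ceil_ratio i (n - 2 * k))
       (2 * ceil_ratio (k - i) (n - 2 * k) + 1).

(* The minimum of F 1, ..., F k for k >= 1; the default F 1 is in the range. *)
Definition min1 (k : nat) (F : nat -> int) : int :=
  \big[Num.min/F 1%N]_(1 <= j < k.+1) F j.

(* Main.v *)
Require Import Defs.
From mathcomp Require Import all_boot all_order all_algebra.
From mathcomp Require Import zify ring lra.

Import Order.TTheory GRing.Theory Num.Theory.
Local Open Scope ring_scope.

(* Both graph powers contain the union of the Johnson scheme relations |A \ B| = i
   for i in the given index set S, so Hoffman's ratio bound applies to the matrix M of
   that union. The spectrum of M is computed on explicit vectors: for disjoint
   pairs (a_1, b_1), ..., (a_j, b_j) with j <= min(k, n - k), the vector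
   A |-> prod_s ([a_s in A] - [b_s in A]) is an eigenvector of the i-th relation.
   Its eigenvalue is found by splitting off one pair at a time, which is the
   recurrence of the Eberlein polynomials in j. These vectors have no common
   nonzero orthogonal vector, and the eigenvalues of the relation i = 1 separate
   the values of j, so the smallest eigenvalue of M on the complement of the
   constants is at least the minimum in the statement. *)

Set Implicit Arguments.
Unset Strict Implicit.

(** * Eberlein polynomials and their recurrence *)

Definition eberlein_coef (j p q i : nat) : rat :=
  \sum_(0 <= t < i.+1) (-1) ^+ t * 'C(j, t)%:R * 'C(p, i - t)%:R * 'C(q, i - t)%:R.

Lemma eberlein_coef0 p q i : eberlein_coef 0 p q i = ('C(p, i) * 'C(q, i))%:R.
Proof.
rewrite /eberlein_coef big_nat_recl // big1 ?addr0 => [|t _].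
  by rewrite subn0 natrM expr0 bin0 !mul1r.
by rewrite bin0n mulr0 !mul0r.
Qed.

(** With $p = k-j$ and $q = n-k-j$ treated as independent parameters, the generating function in [i]
    is $(1-z)^j \sum_l \binom{p}{l}\binom{q}{l} z^l$, so one more unit of [j] is one more factor
    $1-z$. *)
Lemma eberlein_coefS j p q i :
  eberlein_coef j.+1 p q i =
  eberlein_coef j p q i - (if i is i'.+1 then eberlein_coef j p q i' else 0).
Proof.
rewrite /eberlein_coef; case: i => [|i]; first by rewrite !big_nat1 !bin0 subr0.
rewrite big_nat_recl // [in RHS]big_nat_recl // !bin0 -addrA; congr (_ + _).
rewrite -sumrB; apply: eq_bigr => t _.
by rewrite binS natrD subSS exprS; ring.
Qed.

(** * Signed sums over subsets and the eigenvector identity *)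

Section SubsetSums.
Variable X : finType.
Implicit Types (a b : X) (A B R : {set X}) (s : seq (X * X)) (F w : {set X} -> rat).

Lemma sum_subset_split R a F : a \in R ->
  \sum_(B : {set X} | B \subset R) F B =
  \sum_(B : {set X} | B \subset R :\ a) (F (a |: B) + F B).
Proof.
move=> aR; rewrite (bigID (fun B : {set X} => a \in B)) big_split /=.
congr (_ + _); last by apply: eq_bigl => B; rewrite subsetD1.
rewrite (reindex_onto (fun B => a |: B) (fun B => B :\ a)) /=; last first.
  by move=> B /andP[_ aB]; rewrite setD1K.
apply: eq_bigl => B; rewrite subUset sub1set aR setU11 subsetD1 andbT /=.
congr (_ && _); apply/eqP/idP => [<-|aB]; first by rewrite setD11.
by rewrite setU1K.
Qed.

Definition endpoints s : seq X := flatten [seq [:: ab.1; ab.2] | ab <- s].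

(** This is the Specht polynomial $\prod (x_a - x_b)$ of a two-row shape, evaluated at the indicator
    vector of [B]. *)
Definition pair_sign s B : rat :=
  \prod_(ab <- s) ((ab.1 \in B)%:R - (ab.2 \in B)%:R).

Lemma eq_pair_sign s A B : {in endpoints s, A =i B} -> pair_sign s A = pair_sign s B.
Proof.
rewrite /pair_sign; elim: s => [|[a b] s IHs] eqAB; first by rewrite !big_nil.
rewrite !big_cons /= !eqAB ?inE ?eqxx ?orbT // IHs // => x xs.
by apply: eqAB; rewrite /endpoints /= !inE xs !orbT.
Qed.

Lemma pair_signU1 s a B : a \notin endpoints s -> pair_sign s (a |: B) = pair_sign s B.
Proof.
move=> as_; apply: eq_pair_sign => x xs; rewrite !inE.
by case: eqP => // xa; rewrite -xa xs in as_.
Qed.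

Lemma pair_signD1 s a B : a \notin endpoints s -> pair_sign s (B :\ a) = pair_sign s B.
Proof.
move=> as_; apply: eq_pair_sign => x xs; rewrite !inE.
by case: eqP => // xa; rewrite -xa xs in as_.
Qed.

(** A set containing both or neither of [a], [b] has sign 0; the others contribute with sign + for
    [a] and - for [b]. *)
Lemma sum_pair_sign_cons R a b s F :
    a \in R -> b \in R -> uniq (endpoints ((a, b) :: s)) ->
  \sum_(B : {set X} | B \subset R) F B * pair_sign ((a, b) :: s) B =
  \sum_(B : {set X} | B \subset R :\ a :\ b)
     (F (a |: B) - F (b |: B)) * pair_sign s B.
Proof.
move=> aR bR /=; rewrite inE negb_or -!andbA => /and4P[ab as_ bs us].
rewrite (sum_subset_split _ aR) (@sum_subset_split _ b) ?inE 1?eq_sym ?ab //.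
apply: eq_bigr => B; rewrite !subsetD1 => /andP[/andP[_ aB] bB].
have ba : b != a by rewrite eq_sym.
rewrite /pair_sign !big_cons -!/(pair_sign _ _) !inE !eqxx (negPf ab) (negPf ba).
rewrite (negPf aB) (negPf bB) /= !pair_signU1 //; ring.
Qed.

Lemma card_setD_U1 a b A B : a != b -> a \notin B -> b \notin B ->
  #|A :\: (a |: B)| = ((b \in A) + #|A :\ a :\ b :\: B|)%N
  /\ #|(a |: B) :\: A| = ((a \notin A) + #|B :\: (A :\ a :\ b)|)%N.
Proof.
move=> ab aB bB; split.
  rewrite (cardsD1 b) !inE [b == a]eq_sym (negPf ab) (negPf bB) /=.
  congr (_ + #|pred_of_set _|)%N; apply/setP=> x; rewrite !inE.
  by case: (x == b); case: (x == a); rewrite ?andbF.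
rewrite (cardsD1 a) !inE eqxx andbT /=.
congr (_ + #|pred_of_set _|)%N; apply/setP=> x; rewrite !inE.
case: eqP => [->|_]; first by rewrite (negPf aB) andbF.
by case: eqP => [->|_]; rewrite ?(negPf bB) ?andbF.
Qed.

(** Testing both differences forces [A] and [B] to have equal size, so sums may run over subsets of
    every size. *)
Definition dist_ind i A B : rat := ((#|A :\: B| == i) && (#|B :\: A| == i))%:R.

(** The elements removed from [A] and those added from [R :\: A] are chosen independently and
    determine [B]. *)
Lemma sum_dist_ind R A i : A \subset R ->
  \sum_(B : {set X} | B \subset R) dist_ind i A B
  = ('C(#|A|, i) * 'C(#|R :\: A|, i))%:R.
Proof.
move=> AR; rewrite -natr_sum; congr (_%:R).
rewrite (_ : (\sum_(B | _) _)%N =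
  #|[set B : {set X} | [&& B \subset R, #|A :\: B| == i & #|B :\: A| == i]]|); last first.
  rewrite -sum1_card big_mkcond [RHS]big_mkcond; apply: eq_bigr => B _ /=.
  by rewrite inE; case: (B \subset R) => //=; case: (_ && _).
rewrite -!cards_draws -cardsX; symmetry.
set P := setX _ _.
pose h (CD : {set X} * {set X}) := (A :\: CD.1) :|: CD.2.
have hD (C D : {set X}) : C \subset A -> D \subset R :\: A ->
    A :\: h (C, D) = C /\ h (C, D) :\: A = D.
  move=> /subsetP CA /subsetP DA; split; apply/setP=> x; rewrite !inE /=;
    have /implyP := CA x; have /implyP := DA x; rewrite !inE;
    by case: (x \in A); case: (x \in C); case: (x \in D); case: (x \in R).
have injh : {in P &, injective h}.
  move=> [C D] [C' D']; rewrite !inE /=.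
  move=> /andP[/andP[c _] /andP[d _]] /andP[/andP[c' _] /andP[d' _]] e.
  have := hD C D c d; have := hD C' D' c' d'.
  by rewrite e => -[-> ->] [-> ->].
rewrite -(card_in_imset injh).
congr #|pred_of_set _|; apply/setP=> B; apply/imsetP/idP => [[[C D]]|].
  rewrite !inE /= => /andP[/andP[c /eqP ci] /andP[d /eqP di]] ->.
  have [-> ->] := hD C D c d; rewrite ci di !eqxx !andbT.
  rewrite subUset (subset_trans (subsetDl _ _) AR).
  by apply: subset_trans d (subsetDl _ _).
rewrite inE => /and3P[BR p q]; exists (A :\: B, B :\: A).
  by rewrite !inE /= p q subsetDl setSD.
by apply/setP=> x; rewrite !inE /=; case: (x \in A); case: (x \in B).
Qed.

(** Induction on the pairs. The ground set [R] is arbitrary because each step deletes one pair from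
    it. *)
Lemma sum_dist_ind_pair_sign R A s i :
    A \subset R -> uniq (endpoints s) -> {subset endpoints s <= R} ->
  \sum_(B : {set X} | B \subset R) dist_ind i A B * pair_sign s B =
  eberlein_coef (size s) (#|A| - size s) (#|R :\: A| - size s) i * pair_sign s A.
Proof.
elim: s R A i => [|[a b] s IHs] R A i AR us sR.
  under eq_bigr do rewrite /pair_sign big_nil mulr1.
  by rewrite /pair_sign big_nil mulr1 sum_dist_ind // !subn0 eberlein_coef0.
have [aR bR] : a \in R /\ b \in R by split; apply: sR; rewrite !inE eqxx ?orbT.
rewrite sum_pair_sign_cons //; move: us => /=.
rewrite inE negb_or -!andbA => /and4P[ab as_ bs us].
have ba : b != a by rewrite eq_sym.
set R' := R :\ a :\ b; set A' := A :\ a :\ b.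
have sR' : {subset endpoints s <= R'}.
  move=> x xs; rewrite !inE sR ?inE ?xs ?orbT // andbT.
  by apply/andP; split; [apply: contraNneq bs => <-|apply: contraNneq as_ => <-].
have A'R' : A' \subset R' by rewrite !setSD.
have vA' : pair_sign s A' = pair_sign s A by rewrite !pair_signD1.
have cA : #|A| = ((a \in A) + ((b \in A) + #|A'|))%N.
  by rewrite (cardsD1 a) (cardsD1 b (A :\ a)) !inE ba.
have cD : #|R :\: A| = ((a \notin A) + ((b \notin A) + #|R' :\: A'|))%N.
  rewrite (cardsD1 a) (cardsD1 b ((R :\: A) :\ a)) !inE ba aR bR !andbT /=.
  congr (_ + (_ + #|pred_of_set _|))%N; apply/setP=> x; rewrite !inE.
  by case: (x == a); case: (x == b); rewrite ?andbF.
(* If [A] contains both or neither of [a], [b], the two indicators agree. Otherwise adding to [B]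
   the one in [A] keeps the distance of [A'] and [B], and adding the other raises it by one. *)
have dist_U B : B \subset R' ->
     dist_ind i A (a |: B) - dist_ind i A (b |: B) =
     ((a \in A)%:R - (b \in A)%:R) *
     (dist_ind i A' B - (if i is i'.+1 then dist_ind i' A' B else 0)).
  rewrite !subsetD1 => /andP[/andP[_ aB] bB]; rewrite /dist_ind.
  have [-> ->] := card_setD_U1 A ab aB bB; have [-> ->] := card_setD_U1 A ba bB aB.
  rewrite -/A' (_ : A :\ b :\ a = A'); last by rewrite /A' !setDDl setUC.
  case: (a \in A); case: (b \in A); rewrite /= ?add0n ?add1n ?subrr ?mul0r //;
    case: i => [|i]; rewrite ?eqSS /=; ring.
under eq_bigr => B BR' do rewrite dist_U // -mulrA [X in _ * X]mulrBl.
rewrite -mulr_sumr sumrB IHs //.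
rewrite vA' [pair_sign ((a, b) :: s) A]big_cons -/(pair_sign s A) /= eberlein_coefS cA cD.
have -> : \sum_(B : {set X} | B \subset R')
    (if i is i'.+1 then dist_ind i' A' B else 0) * pair_sign s B =
   (if i is i'.+1 then eberlein_coef (size s) (#|A'| - size s) (#|R' :\: A'| - size s) i' else 0)
   * pair_sign s A.
  case: i {dist_U} => [|i]; last by rewrite IHs // vA'.
  by rewrite mul0r big1 // => B _; rewrite mul0r.
(* When the sign is nonzero, [#|A|] and [#|R :\: A|] each lose one together with the number of
   pairs, so p and q are unchanged, as in [eberlein_coefS]. *)
case: (a \in A); case: (b \in A); rewrite /= ?subrr ?mul0r //=;
  rewrite ?add1n ?add0n ?subSS; case: (i) => [|?]; ring.
Qed.

End SubsetSums.

(** * Positive semidefiniteness from a complete family of eigenvectors *)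

(* Eigenvectors with the same eigenvalue of A have the same eigenvalue of M, and
   the others are orthogonal; so in an expansion w = sum_i c_i V_i only the
   products within a level survive, and they group into squares. *)
Lemma psd_of_eigenvectors (T I : finType) (K : nat) (lev : I -> 'I_K)
    (V : I -> T -> rat) (A M : T -> T -> rat) (theta mu : 'I_K -> rat) :
    (forall x y, A x y = A y x) ->
    (forall i x, \sum_y A x y * V i y = theta (lev i) * V i x) ->
    (forall i x, \sum_y M x y * V i y = mu (lev i) * V i x) ->
    injective theta -> (forall i, 0 <= mu (lev i)) ->
    (forall w : T -> rat, (forall i, \sum_x w x * V i x = 0) -> forall x, w x = 0) ->
  forall w : T -> rat, 0 <= \sum_x w x * \sum_y M x y * w y.
Proof.
move=> symA eigA eigM inj_theta mu_ge0 complete w.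
have orthV i i' : lev i != lev i' -> \sum_x V i x * V i' x = 0.
  move=> ne; apply/eqP.
  have ne' : theta (lev i) - theta (lev i') != 0.
    by rewrite subr_eq0; apply: contraNneq ne => /inj_theta ->.
  rewrite -(mulrI_eq0 _ (mulfI ne')) mulrBl !mulr_sumr.
  rewrite subr_eq0; apply/eqP.
  under eq_bigr => x _ do rewrite mulrA -eigA mulr_suml.
  rewrite exchange_big; apply: eq_bigr => x _ /=.
  rewrite mulrCA -eigA mulr_sumr; apply: eq_bigr => y _.
  by rewrite symA; ring.
pose P : 'M[rat]_(#|I|, #|T|) := \matrix_(i, x) V (enum_val i) (enum_val x).
(* Columns of the cokernel of [P] are orthogonal to every [V i], hence zero; so the [V i] span and
   [w] expands in them. *)
have fullP : row_full P.
  rewrite -cokermx_eq0; apply/eqP/matrixP=> x z; rewrite [RHS]mxE.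
  rewrite -[x]enum_valK.
  apply: (complete (fun y => cokermx P (enum_rank y) z)) => i.
  have /matrixP/(_ (enum_rank i) z) := mulmx_coker P.
  rewrite [RHS]mxE mxE => {2}<-.
  rewrite (reindex_onto enum_val enum_rank) /=; last by move=> ? _; rewrite enum_rankK.
  apply: eq_big => y; first by rewrite enum_valK eqxx.
  by rewrite enum_valK [P _ _]mxE enum_rankK mulrC.
have [D wD] := submxP (submx_full (\row_x w (enum_val x)) fullP).
pose c i := D 0 (enum_rank i).
have {wD} wE x : w x = \sum_i c i * V i x.
  have /matrixP/(_ 0 (enum_rank x)) := wD; rewrite !mxE enum_rankK => ->.
  rewrite [RHS](reindex_onto enum_val enum_rank) /=; last by move=> ? _; rewrite enum_rankK.
  apply: eq_big => i; first by rewrite enum_valK eqxx.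
  by rewrite /c enum_valK mxE enum_rankK.
have MwE x : \sum_y M x y * w y = \sum_i c i * mu (lev i) * V i x.
  under eq_bigr => y _ do rewrite wE mulr_sumr.
  rewrite exchange_big; apply: eq_bigr => i _ /=; rewrite -mulrA -eigM mulr_sumr.
  by apply: eq_bigr => y _; rewrite mulrCA.
pose W j x := \sum_(i | lev i == j) c i * V i x.
have -> : \sum_x w x * \sum_y M x y * w y = \sum_j \sum_x mu j * (W j x) ^+ 2.
  transitivity (\sum_i \sum_i' c i * (c i' * mu (lev i')) * \sum_x V i x * V i' x).
    under eq_bigr => x _.
      rewrite MwE wE mulr_suml; under eq_bigr => i _ do rewrite mulr_sumr.
      over.
    rewrite exchange_big; apply: eq_bigr => i _ /=.
    rewrite exchange_big; apply: eq_bigr => i' _ /=.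
    by rewrite mulr_sumr; apply: eq_bigr => x _; ring.
  rewrite (partition_big lev xpredT) //=; apply: eq_bigr => j _.
  transitivity (\sum_(i | lev i == j) \sum_(i' | lev i' == j) 
     c i * (c i' * mu (lev i')) * \sum_x V i x * V i' x).
    apply: eq_bigr => i /eqP <-; rewrite [RHS]big_mkcond; apply: eq_bigr => i' _.
    by case: ifPn => //; rewrite eq_sym => /orthV ->; rewrite mulr0.
  rewrite /W; under [RHS]eq_bigr => x _.
    rewrite expr2 mulrCA mulr_suml; under eq_bigr => i _ do rewrite !mulr_sumr.
    over.
  rewrite [RHS]exchange_big; apply: eq_bigr => i _ /=.
  rewrite [RHS]exchange_big; apply: eq_bigr => i' /eqP -> /=.
  by rewrite mulr_sumr; apply: eq_bigr => x _; ring.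
(* The hypothesis gives [mu j >= 0] only at levels that are attained; at any other level [W j] is an
   empty sum. *)
apply: sumr_ge0 => j _; case: (pickP (fun i => lev i == j)) => [i /eqP <-|no].
  by apply: sumr_ge0 => x _; rewrite mulr_ge0 ?sqr_ge0.
by apply: sumr_ge0 => x _; rewrite /W big_pred0 // expr0n mulr0.
Qed.

(** * Completeness of the pair-sign vectors *)

Section Completeness.
Variable X : finType.
Implicit Types (a b : X) (B L R : {set X}) (s : seq (X * X)) (w : {set X} -> rat).

(** Iterated difference: the signed sum of [w] over the sets obtained from [L] by adding one
    endpoint of each pair. *)
Fixpoint iter_diff s w : {set X} -> rat :=
  if s is ab :: s' then iter_diff s' (fun L => w (ab.1 |: L) - w (ab.2 |: L)) else w.

Lemma iter_diff_rcons s a b w L :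
  iter_diff (rcons s (a, b)) w L = iter_diff s w (a |: L) - iter_diff s w (b |: L).
Proof. by elim: s w => //= ab s IHs w; rewrite IHs. Qed.

Lemma endpoints_rcons s a b : endpoints (rcons s (a, b)) = endpoints s ++ [:: a; b].
Proof. by rewrite /endpoints map_rcons -cats1 flatten_cat. Qed.

Lemma uniq_endpoints_rcons s a b :
  uniq (endpoints (rcons s (a, b))) =
  [&& uniq (endpoints s), a \notin endpoints s, b \notin endpoints s & a != b].
Proof.
by rewrite endpoints_rcons cat_uniq /= orbF negb_or !andbT mem_seq1 -!andbA.
Qed.

Lemma size_endpoints s : size (endpoints s) = (2 * size s)%N.
Proof. by elim: s => //= ab s; rewrite /endpoints /= => ->; lia. Qed.

Lemma sum_pair_sign R s w :
    uniq (endpoints s) -> {subset endpoints s <= R} ->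
  \sum_(B : {set X} | B \subset R) w B * pair_sign s B =
  \sum_(B : {set X} | B \subset R :\: [set:: endpoints s]) iter_diff s w B.
Proof.
elim: s R w => [|[a b] s IHs] R w us sR.
  rewrite /= (_ : [set:: _] = set0) ?setD0; last by apply/setP=> x; rewrite !inE.
  by apply: eq_bigr => B _; rewrite /pair_sign big_nil mulr1.
have [aR bR] : a \in R /\ b \in R by split; apply: sR; rewrite !inE eqxx ?orbT.
rewrite sum_pair_sign_cons //; move: us => /=.
rewrite inE negb_or -!andbA => /and4P[ab as_ bs us].
rewrite IHs //; last first.
  move=> x xs; rewrite !inE sR ?inE ?xs ?orbT // andbT.
  by apply/andP; split; [apply: contraNneq bs => <-|apply: contraNneq as_ => <-].
suff -> : R :\: [set:: endpoints ((a, b) :: s)] = R :\ a :\ b :\: [set:: endpoints s] by [].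
apply/setP=> x; rewrite !inE !negb_or.
by case: (x == a); case: (x == b); case: (x \in R); rewrite ?andbF ?andbT.
Qed.

(** Every set in the signed sum has size [#|L| + size s], where [w] vanishes. *)
Lemma iter_diff_support k s w L :
    (forall B, #|B| != k -> w B = 0) -> uniq (endpoints s) ->
    {in endpoints s, forall x, x \notin L} -> (#|L| + size s)%N != k ->
  iter_diff s w L = 0.
Proof.
move=> w0; elim/last_ind: s L => [|s [a b] IHs] L; first by rewrite addn0 => _ _ /w0.
rewrite uniq_endpoints_rcons endpoints_rcons => /and4P[us as_ bs ab].
move=> sL; rewrite size_rcons iter_diff_rcons => nk.
have [aL bL] : a \notin L /\ b \notin L.
  by split; apply: sL; rewrite mem_cat !inE eqxx ?orbT.
have sL' c : c \notin endpoints s -> {in endpoints s, forall x, x \notin c |: L}.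
  move=> cs x xs; rewrite !inE negb_or sL ?mem_cat ?xs // andbT.
  by apply: contraNneq cs => <-.
by rewrite !IHs ?subrr //; try exact: sL'; rewrite cardsU1 ?aL ?bL; lia.
Qed.

(* Downward induction on the number of pairs: if the differences along one more
   pair vanish, then [iter_diff s w] is constant on the sets L of the right size,
   and its sum over them vanishes by hypothesis. *)
Lemma pair_sign_complete k w : (k <= #|X|)%N ->
    (forall B, #|B| != k -> w B = 0) ->
    (forall s, uniq (endpoints s) -> (size s <= minn k (#|X| - k))%N ->
       \sum_(B : {set X}) w B * pair_sign s B = 0) ->
  forall B, w B = 0.
Proof.
set K := minn _ _ => kX w0 orth.
suff main d s L : (size s + d = K)%N -> uniq (endpoints s) ->
    {in endpoints s, forall x, x \notin L} -> (#|L| + size s = k)%N ->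
    iter_diff s w L = 0.
  move=> B; case: (eqVneq #|B| k) => [Bk|]; last exact: w0.
  by apply: (main K [::] B); rewrite //= addn0.
(* If the iterated difference is constant on admissible sets, its vanishing sum is that constant
   times their number, which is positive since [L] is one of them. *)
have concl : forall s L, (size s <= K)%N -> uniq (endpoints s) ->
    {in endpoints s, forall x, x \notin L} -> (#|L| + size s = k)%N ->
    (forall L', {in endpoints s, forall x, x \notin L'} -> (#|L'| + size s = k)%N ->
       iter_diff s w L' = iter_diff s w L) -> iter_diff s w L = 0.
  move=> {}s {}L sK us sL Lk cst.
  have := orth s us sK.
  rewrite (eq_bigl (fun B : {set X} => B \subset setT)); last by move=> B; rewrite subsetT.
  rewrite sum_pair_sign // ?setTD; last by move=> x _; rewrite inE.
  rewrite (bigID (fun B : {set X} => #|B| + size s == k)%N) /= [X in _ + X]big1 ?addr0; last first.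
    move=> B /andP[/subsetP sB]; apply: iter_diff_support => // x xs.
    by apply/negP=> /sB; rewrite !inE xs.
  rewrite (eq_bigr (fun=> iter_diff s w L)); last first.
    move=> B /andP[/subsetP sB /eqP Bk]; apply: cst => // x xs.
    by apply/negP=> /sB; rewrite !inE xs.
  rewrite sumr_const => /eqP; rewrite mulrn_eq0 => /orP[|/eqP //].
  move/eqP/card0_eq/(_ L); rewrite !unfold_in /= Lk eqxx andbT => /negP[].
  by apply/subsetP=> x xL; rewrite !inE; apply: contraL xL => /sL.
elim: d s L => [|d IHd] s L sd us sL Lk; apply: concl => // [|L' sL' L'k].
- by lia.
(* With [K] pairs only one [L] is admissible: the empty set if [K = k], and otherwise the whole
   complement of the endpoints. *)
- congr (iter_diff s w _).
  have sub (L0 : {set X}) : {in endpoints s, forall x, x \notin L0} ->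
      L0 \subset ~: [set:: endpoints s].
    by move=> sL0; apply/subsetP=> x xL; rewrite !inE; apply: contraL xL => /sL0.
  have cC : #|~: [set:: endpoints s]| = (#|X| - 2 * size s)%N.
    by rewrite cardsCs setCK cardsE (card_uniqP us) size_endpoints.
  have eqc (L0 : {set X}) : {in endpoints s, forall x, x \notin L0} ->
      (#|L0| + size s = k)%N -> (k <= #|X| - k)%N = false ->
      L0 = ~: [set:: endpoints s].
    move=> s0 k0 kn; apply/eqP; rewrite eqEcard sub //= cC; move: sd k0 kn; rewrite /K; lia.
  case kn: (k <= #|X| - k)%N; last by rewrite (eqc L) // (eqc L').
  have e0 (L0 : {set X}) : (#|L0| + size s = k)%N -> L0 = set0.
    by move=> k0; apply/eqP; rewrite -cards_eq0; move: sd k0 kn; rewrite /K; lia.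
  by rewrite (e0 L) // (e0 L').
- by lia.
(* Move [L'] towards [L] by replacing [a] with [b]. The change is the iterated difference along [s]
   and the new pair [(a, b)], which vanishes by [IHd]. *)
have [N] := ubnP #|L' :\: L|; elim: N L' sL' L'k => // N IHN L' sL' L'k ltN.
  case: (set_0Vmem (L' :\: L)) => [/eqP|[a]].
    rewrite setD_eq0 => sub; congr (iter_diff s w _); apply/eqP.
    by rewrite eqEcard sub; lia.
  rewrite inE => /andP[aL aL'].
  case: (set_0Vmem (L :\: L')) => [/eqP|[b]].
    rewrite setD_eq0 => sub; suff e : L = L' by rewrite e aL' in aL.
    by apply/eqP; rewrite eqEcard sub; lia.
  rewrite inE => /andP[bL' bL].
  have ab : a != b by apply: contraNneq aL => ->.
  have as_ : a \notin endpoints s by apply: contraL aL' => /sL'.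
  have bs : b \notin endpoints s by apply: contraL bL => /sL.
  have cD : #|L'| = #|L' :\ a|.+1 by rewrite (cardsD1 a L') aL'.
  have /eqP -> : iter_diff s w L' == iter_diff s w (b |: L' :\ a).
    rewrite -subr_eq0 -{1}(setD1K aL') -iter_diff_rcons; apply/eqP; apply: IHd.
    + by rewrite size_rcons; lia.
    + by rewrite uniq_endpoints_rcons us as_ bs.
    + move=> x; rewrite endpoints_rcons mem_cat !inE.
      case/or3P => [/sL' /negPf ->|/eqP ->|/eqP ->]; rewrite ?andbF ?eqxx //.
      by rewrite (negPf bL') andbF.
    + by rewrite size_rcons; lia.
  apply: IHN.
  + move=> x xs; rewrite !inE !negb_or negb_and (negPf (sL' x xs)) orbT andbT.
    by apply: contraNneq bs => <-.
  + by rewrite cardsU1 !inE (negPf bL') andbF; lia.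
  + have : (b |: L' :\ a) :\: L \proper L' :\: L.
      apply/properP; split; last by exists a; rewrite !inE ?aL ?aL' ?(negPf ab) ?eqxx.
      by apply/subsetP=> x; rewrite !inE; case: eqP => [->|_]; [rewrite bL|case/andP=> -> /andP[]].
    by move/proper_card => lt; apply: leq_trans lt _; rewrite -ltnS.
Qed.

End Completeness.

(** * Exchanging elements between sets of equal size *)

Lemma exists_subset_card (X : finType) (A : {set X}) m :
  (m <= #|A|)%N -> exists2 B : {set X}, B \subset A & #|B| = m.
Proof.
rewrite -bin_gt0 -cards_draws => /card_gt0P[B]; rewrite inE => /andP[BA /eqP Bm].
by exists B.
Qed.

(** Exchange m elements [Y] of [A :\: B] for m elements [Z] of [B :\: A]. *)
Lemma exists_intermediate_set (X : finType) (A B : {set X}) m :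
    #|A| = #|B| -> (m <= #|A :\: B|)%N ->
  exists C : {set X}, [/\ #|C| = #|A|, #|A :\: C| = m & #|C :\: B| = (#|A :\: B| - m)%N].
Proof.
move=> AB mAB; have DAB : #|A :\: B| = #|B :\: A|.
  by apply/eqP; rewrite -(eqn_add2l #|A :&: B|) cardsID setIC cardsID AB.
have [Y YAB Ym] := exists_subset_card mAB.
have [Z ZBA Zm] : exists2 Z : {set X}, Z \subset B :\: A & #|Z| = m.
  by apply: exists_subset_card; rewrite -DAB.
have YA : Y \subset A by apply: subset_trans YAB (subsetDl _ _).
have AC : A :\: (A :\: Y :|: Z) = Y.
  apply/setP=> x; rewrite !inE; have /implyP := subsetP YAB x; have /implyP := subsetP ZBA x.
  by rewrite !inE; case: (x \in A); case: (x \in B); case: (x \in Y); case: (x \in Z).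
have CA : (A :\: Y :|: Z) :\: A = Z.
  apply/setP=> x; rewrite !inE; have /implyP := subsetP YAB x; have /implyP := subsetP ZBA x.
  by rewrite !inE; case: (x \in A); case: (x \in B); case: (x \in Y); case: (x \in Z).
have CB : (A :\: Y :|: Z) :\: B = (A :\: B) :\: Y.
  apply/setP=> x; rewrite !inE; have /implyP := subsetP YAB x; have /implyP := subsetP ZBA x.
  by rewrite !inE; case: (x \in A); case: (x \in B); case: (x \in Y); case: (x \in Z).
exists (A :\: Y :|: Z); rewrite AC CB cardsDS // Ym; split => //.
by rewrite -(cardsID A) CA Zm -[RHS](cardsID (A :\: Y :|: Z)) AC Ym setIC.
Qed.

(** * Walks of prescribed length *)

Section Walks.
Variables (T : finType) (e : rel T).

Definition has_walk (m : nat) (x y : T) : Prop :=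
  exists s, [/\ path e x s, last x s = y & size s = m].

Lemma has_walk0 x : has_walk 0 x x.
Proof. by exists [::]. Qed.

Lemma has_walkS m x y z : e x y -> has_walk m y z -> has_walk m.+1 x z.
Proof. by move=> exy [s [es ls <-]]; exists (y :: s); rewrite /= exy. Qed.

Lemma gpower_walk p m x y : has_walk m x y -> x != y -> (m <= p)%N -> gpower e p x y.
Proof.
move=> [s [es ls sm]] xy mp; rewrite /gpower xy (leq_trans (gdist_min es ls sm) mp) andbT.
by apply/connectP; exists s.
Qed.

End Walks.

(** * Walks in Johnson and Kneser graphs *)

Section KSubsets.
Variables n k : nat.
Implicit Types A B C : ksubset n k.

Lemma card_ksubset A : #|val A| = k.
Proof. exact/eqP/(valP A). Qed.

Lemma ksubset_of (S : {set 'I_n}) : #|S| = k -> exists A : ksubset n k, val A = S.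
Proof. by move/eqP=> Sk; exists (exist _ S Sk). Qed.

Lemma ksubset_inj A B : #|val A :\: val B| = 0%N -> A = B.
Proof.
move/eqP; rewrite cards_eq0 setD_eq0 => sub; apply/val_inj/eqP.
by rewrite eqEcard sub !card_ksubset leqnn.
Qed.

Lemma card_ksubsetDC A B : #|val A :\: val B| = #|val B :\: val A|.
Proof.
have := cardsID (val B) (val A); have := cardsID (val A) (val B).
by rewrite setIC !card_ksubset; lia.
Qed.

Lemma ksubset_intermediate A B m : (m <= #|val A :\: val B|)%N ->
  exists C, #|val A :\: val C| = m /\ #|val C :\: val B| = (#|val A :\: val B| - m)%N.
Proof.
move=> /exists_intermediate_set[|S [Sk AS SB]]; first by rewrite !card_ksubset.
have [|C CS] := @ksubset_of S; first by rewrite Sk card_ksubset.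
by exists C; rewrite CS.
Qed.

Lemma johnson_walk i A B : #|val A :\: val B| = i -> has_walk (@johnson n k) i A B.
Proof.
elim: i A => [|i IHi] A AB; first by rewrite (ksubset_inj AB); apply: has_walk0.
have [|C [AC CB]] := @ksubset_intermediate A B 1; first by rewrite AB.
apply: (@has_walkS _ _ _ _ C); last by apply: IHi; rewrite CB AB subn1.
apply/eqP; have := cardsID (val C) (val A); rewrite AC card_ksubset; lia.
Qed.

(** The union has $k + |A \setminus B| \le n - k$ elements, so its complement contains a common
    neighbour. *)
Lemma kneser_walk2 A B : (#|val A :\: val B| <= n - 2 * k)%N -> (2 * k <= n)%N ->
  has_walk (@kneser n k) 2 A B.
Proof.
move=> AB kn; have cU : (k <= #|~: (val A :|: val B)|)%N.
  rewrite cardsCs setCK card_ord; have := cardsUI (val A) (val B).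
  by have := cardsID (val B) (val A); rewrite !card_ksubset; lia.
have [S sub /ksubset_of[C CS]] := exists_subset_card cU.
have [AC BC] : [disjoint val A & val C] /\ [disjoint val B & val C].
  rewrite CS; split; rewrite disjoint_sym disjoints_subset; apply: subset_trans sub _;
  by rewrite setCS ?subsetUl ?subsetUr.
by apply: has_walkS AC _; apply: has_walkS (has_walk0 _ _); rewrite /kneser disjoint_sym.
Qed.

Lemma has_walk_cat (e : rel (ksubset n k)) p q A B C :
  has_walk e p A B -> has_walk e q B C -> has_walk e (p + q) A C.
Proof.
move=> [s [es ls <-]] [t [et lt <-]]; exists (s ++ t).
by rewrite cat_path last_cat size_cat es ls et lt.
Qed.

(** Each pair of edges can exchange up to $n - 2k$ elements. *)
Lemma kneser_walk_even c A B : (2 * k <= n)%N -> (#|val A :\: val B| <= c * (n - 2 * k))%N ->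
  has_walk (@kneser n k) (2 * c) A B.
Proof.
move=> kn; elim: c A => [|c IHc] A AB.
  by rewrite (_ : A = B); [apply: has_walk0 | apply: ksubset_inj; lia].
have [|C [AC CB]] := @ksubset_intermediate A B (minn (n - 2 * k) #|val A :\: val B|).
  by rewrite geq_minr.
rewrite mulnS; apply: (@has_walk_cat _ _ _ _ C); first by apply: kneser_walk2; lia.
apply: IHc; rewrite CB; move: AB; rewrite mulSn; move: #|_| (c * _)%N => x y; lia.
Qed.

(** The first edge goes to a set [C] disjoint from [A] and containing all of [B :\: A]. Then $|C
    \setminus B| = k - |A \setminus B|$, and an even walk finishes. *)
Lemma kneser_walk_odd c A B : (2 * k <= n)%N ->
    (k - #|val A :\: val B| <= c * (n - 2 * k))%N ->
  has_walk (@kneser n k) (2 * c + 1) A B.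
Proof.
move=> kn AB; have cU : (k - #|val B :\: val A| <= #|~: (val A :|: val B)|)%N.
  rewrite [#|~: _|]cardsCs setCK card_ord; have := cardsUI (val A) (val B).
  by have := cardsID (val A) (val B); rewrite !card_ksubset setIC; lia.
have [S sub Sk] := exists_subset_card cU.
have dS : [disjoint S & val B :\: val A].
  rewrite disjoints_subset; apply: subset_trans sub _; apply/subsetP=> x.
  by rewrite !inE; case: (x \in val A).
have cB : (#|val B :\: val A| <= k)%N 
    by apply: leq_trans (subset_leq_card (subsetDl _ _)) _; rewrite card_ksubset.
have [|C CS] := @ksubset_of (S :|: (val B :\: val A)).
  by move: dS; rewrite -leq_card_setU => /eqP ->; rewrite Sk subnK.
rewrite addn1; apply: (@has_walkS _ _ _ _ C).
  rewrite /kneser CS disjoint_sym disjoints_subset subUset subsetDr andbT.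
  by apply: subset_trans sub _; rewrite setCS subsetUl.
have CB : val C :\: val B = S.
  apply/setP=> x; rewrite CS !inE; have /implyP := subsetP sub x; rewrite !inE.
  by case: (x \in val A); case: (x \in val B); case: (x \in S).
by apply: kneser_walk_even => //; rewrite CB Sk -card_ksubsetDC.
Qed.

Lemma ceil_ratio_ge i m : (0 < m)%N -> (i <= ceil_ratio i m * m)%N.
Proof.
move=> m0; rewrite -(ler_nat rat) natrM -ler_pdivrMr ?ltr0n //.
apply: le_trans (ceil_ge _) _; rewrite /ceil_ratio natr_absz.
by rewrite ler_int ler_norm.
Qed.

Lemma gpower_johnson p i A B : #|val A :\: val B| = i -> (1 <= i <= p)%N ->
  gpower (@johnson n k) p A B.
Proof.
move=> AB /andP[i1 ip]; apply: gpower_walk (johnson_walk AB) _ ip.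
by apply: contraTneq i1 => e; rewrite -AB e setDv cards0.
Qed.

Lemma gpower_kneser p i A B : (2 * k < n)%N -> #|val A :\: val B| = i ->
  (1 <= delta n k i <= p)%N -> gpower (@kneser n k) p A B.
Proof.
move=> kn AB /andP[i1 ip]; have m0 : (0 < n - 2 * k)%N by lia.
(* If [A = B] then [i = 0], and [delta n k 0 = 0] is excluded by the lower bound 1. *)
have AneB : A != B.
  apply: contraTneq i1 => e; rewrite -AB e setDv cards0 /delta /ceil_ratio.
  by rewrite mul0r ceil0 min0n.
(* The two arguments of the minimum are the lengths of the even and the odd walk. *)
move: ip; rewrite /delta geq_min => /orP[]; apply: gpower_walk => //.
  by apply: kneser_walk_even; [lia | rewrite AB ceil_ratio_ge].
by apply: kneser_walk_odd; [lia | rewrite AB ceil_ratio_ge].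
Qed.

End KSubsets.

(** * Hoffman's ratio bound for the chromatic number *)

(** For constant row sum [d] and other eigenvalues at least [m], the shifted matrix is positive
    semidefinite: the all-ones term brings the constants to eigenvalue 0. Testing on colour classes
    bounds their sizes. *)
Lemma ratio_bound (T : finType) (e : rel T) (M : T -> T -> rat) (d m : rat) :
    (0 < #|T|)%N -> irreflexive e -> 0 <= d ->
    (forall x y, ~~ e x y -> M x y = 0) ->
    (forall w : T -> rat, 0 <= \sum_x w x * 
       \sum_y (M x y - m * (x == y)%:R - (d - m) / #|T|%:R) * w y) ->
  1 + d / - m <= (chi e)%:R.
Proof.
move=> T0 irr d0 Me psd; have N0 : 0 < #|T|%:R :> rat by rewrite ltr0n.
have /existsP[f /forallP col] := chi_colorable irr.
have chi1 : 1 <= (chi e)%:R :> rat.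
  by case/card_gt0P: T0 => x _; rewrite ler1n; case: (f x) => i; case: (chi e).
(* For [m >= 0] the fraction is at most 0, with division by zero giving 0 at [m = 0]. *)
case: (ltrP m 0) => m0; last first.
  by apply: le_trans chi1; rewrite gerDl mulr_ge0_le0 // invr_le0 oppr_le0.
(* [M] vanishes inside a colour class, so only the two correction terms survive in the quadratic
   form of its indicator. *)
have class c : #|[set x | f x == c]|%:R * (d - m) <= - m * #|T|%:R.
  set C := [set _ | _]; have cC : \sum_x (x \in C)%:R = #|C|%:R :> rat.
    by rewrite -sum1_card natr_sum [RHS]big_mkcond; apply: eq_bigr => y _; case: ifP.
  have := psd (fun x => (x \in C)%:R).
  have -> : \sum_x (x \in C)%:R *
      \sum_y (M x y - m * (x == y)%:R - (d - m) / #|T|%:R) * (y \in C)%:R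
    = #|C|%:R * (- m - (d - m) / #|T|%:R * #|C|%:R).
    rewrite -[X in X * (_ - _)]cC mulr_suml; apply: eq_bigr => x _.
    case xC: (x \in C); last by rewrite !mul0r.
    rewrite !mul1r; under eq_bigr => y _ do rewrite !mulrBl -mulrA.
    rewrite !sumrB -!mulr_sumr big1 ?sub0r => [|y _]; last first.
      case yC: (y \in C); rewrite ?mulr0 // mulr1 Me //.
      have /forallP/(_ y) := col x; move: xC yC; rewrite !inE => /eqP-> /eqP->.
      by rewrite eqxx implybF.
    rewrite cC; congr (- _ - _).
      rewrite (bigD1 x) //= xC eqxx mulr1 big1 ?addr0 ?mulr1 // => y yx.
      by rewrite eq_sym (negPf yx) mulr0 mul0r.
    ring.
  case: (posnP #|C|) => [->|C0]; first by rewrite !mul0r => _; rewrite mulr_ge0 ?oppr_ge0 ?ltW.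
  rewrite pmulr_rge0 ?ltr0n // subr_ge0 mulrAC ler_pdivrMr // => h.
  by rewrite mulrC.
have tot : #|T|%:R = \sum_c #|[set x | f x == c]|%:R :> rat.
  rewrite -natr_sum -sum1_card (partition_big f xpredT) //=; congr (_%:R).
  by apply: eq_bigr => c _; rewrite -sum1_card; apply: eq_bigl => x; rewrite inE.
have : #|T|%:R * (d - m) <= (chi e)%:R * (- m * #|T|%:R).
  rewrite {1}tot mulr_suml; apply: le_trans (ler_sum _ (fun c _ => class c)) _.
  by rewrite sumr_const card_ord mulr_natl.
rewrite mulrC mulrA ler_pM2r // => h.
have nm : 0 < - m by rewrite oppr_gt0.
rewrite -(ler_pM2r nm); apply: le_trans h; rewrite mulrDl mul1r divfK ?gt_eqF //.
by rewrite addrC.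
Qed.

(** * Spectrum of unions of Johnson scheme relations *)

Lemma eberleinE i j n k : (k <= n)%N -> (j <= minn k (n - k))%N ->
  (eberlein i j n k)%:~R = eberlein_coef j (k - j) (n - k - j) i.
Proof.
move=> kn jK; have binZE (a b : nat) : binZ a%:Z b = ('C(a, b))%:Z.
  by rewrite /binZ ltz_nat; case: ltnP => // /bin_small ->.
rewrite /eberlein /eberlein_coef rmorph_sum /=; apply: eq_bigr => t _.
rewrite (_ : n%:Z - k%:Z - j%:Z = (n - k - j)%N%:Z); last by lia.
rewrite (_ : k%:Z - j%:Z = (k - j)%N%:Z); last by lia.
by rewrite !binZE !rmorphM /= rmorphXn /= rmorphN1.
Qed.

Section JohnsonScheme.
Variables n k : nat.
Hypothesis kn : (k <= n)%N.
Let K := minn k (n - k).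

Lemma sum_ksubset (F : {set 'I_n} -> rat) :
  \sum_(A : ksubset n k) F (val A) = \sum_(B : {set 'I_n} | #|B| == k) F B.
Proof. by rewrite (big_sub (fun B : {set 'I_n} => #|B| == k)). Qed.

Lemma dist_ind_card i (A B : {set 'I_n}) : dist_ind i A B != 0 -> #|A| = #|B|.
Proof.
rewrite /dist_ind; case: (eqVneq #|A :\: B| i) => // e1.
case: (eqVneq #|B :\: A| i) => // e2 _.
by rewrite -(cardsID B A) -(cardsID A B) e1 e2 setIC.
Qed.

Lemma sum_ksubset_dist_ind i s (A : ksubset n k) : uniq (endpoints s) ->
  \sum_(B : ksubset n k) dist_ind i (val A) (val B) * pair_sign s (val B) =
  eberlein_coef (size s) (k - size s) (n - k - size s) i * pair_sign s (val A).
Proof.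
move=> us; rewrite (sum_ksubset (fun B => dist_ind i (val A) B * pair_sign s B)).
have := @sum_dist_ind_pair_sign _ setT (val A) s i (subsetT _) us (fun x _ => in_setT x).
rewrite setTD [#|~: _|]cardsCs setCK card_ord card_ksubset => <-.
rewrite big_mkcond [RHS]big_mkcond; apply: eq_bigr => B _; rewrite subsetT.
case: ifPn => // Bk; case: (eqVneq (dist_ind i (val A) B) 0) => [->|/dist_ind_card e].
  by rewrite mul0r.
by rewrite -e card_ksubset eqxx in Bk.
Qed.

(** The sets [a |: B] and [b |: B] have equal size and cancel. Hence the all-ones correction kills
    every level above 0. *)
Lemma sum_ksubset_pair_sign s : uniq (endpoints s) -> s != [::] ->
  \sum_(B : ksubset n k) pair_sign s (val B) = 0.
Proof.
case: s => // -[a b] s us _; rewrite sum_ksubset big_mkcond /=.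
rewrite (eq_bigr (fun B : {set 'I_n} => (#|B| == k)%:R * pair_sign ((a, b) :: s) B)); last first.
  by move=> B _; case: ifP; rewrite ?mul1r ?mul0r.
rewrite (eq_bigl (fun B : {set 'I_n} => B \subset setT)); last by move=> B; rewrite subsetT.
rewrite sum_pair_sign_cons ?inE // big1 // => B.
rewrite !subsetD1 => /andP[/andP[_ aB] bB].
by rewrite !cardsU1 aB bB subrr mul0r.
Qed.

Lemma eberlein_coef1 j : (j <= K)%N ->
  eberlein_coef j (k - j) (n - k - j) 1 = (k%:R - j%:R) * (n%:R - k%:R - j%:R) - j%:R.
Proof.
move=> jK; rewrite /eberlein_coef big_nat_recl // big_nat1 /= subn0 subnn !bin0 !bin1.
rewrite expr0 expr1 -!natrB; last 3 first.
- by move: jK; rewrite /K; lia.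
- by [].
- by move: jK; rewrite /K; lia.
ring.
Qed.

Lemma psd_johnson_scheme (S : pred nat) (m : rat) :
    let lambda j := \sum_(i < k.+1 | S i) eberlein_coef j (k - j) (n - k - j) i in
    (forall j, (1 <= j <= K)%N -> m <= lambda j) ->
  forall w : ksubset n k -> rat, 0 <= \sum_A w A *
    \sum_B (\sum_(i < k.+1 | S i) dist_ind i (val A) (val B) - m * (A == B)%:R
            - (lambda 0%N - m) / #|ksubset n k|%:R) * w B.
Proof.
move=> lambda m_le.
(* The index is a list of at most [K] disjoint pairs, and its level is its length. *)
pose I : finType := {s : K.-bseq ('I_n * 'I_n) | uniq (endpoints s)}.
have ltK (i : I) : (size (val i) < K.+1)%N by rewrite ltnS size_bseq.
pose lev (i : I) : 'I_K.+1 := Ordinal (ltK i).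
pose V (i : I) (A : ksubset n k) := pair_sign (val i) (val A).
have uI (i : I) : uniq (endpoints (val i)) := valP i.
apply: (@psd_of_eigenvectors _ I K.+1 lev V
  (fun A B => dist_ind 1 (val A) (val B)) _
  (fun j => eberlein_coef j (k - j) (n - k - j) 1)
  (fun j => if j == 0 :> nat then 0 else lambda j - m)).
- by move=> A B; rewrite /dist_ind andbC.
- by move=> i A; apply: sum_ksubset_dist_ind.
- move=> i A.
  under eq_bigr => B _ do rewrite !mulrBl mulr_suml -!mulrA.
  rewrite !sumrB -!mulr_sumr exchange_big /=.
  rewrite (eq_bigr (fun l : 'I_k.+1 =>
    eberlein_coef (lev i) (k - lev i) (n - k - lev i) l * V i A)).
    rewrite -mulr_suml -/(lambda _).
    have -> : \sum_B (A == B)%:R * V i B = V i A.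
      rewrite (bigD1 A) //= eqxx mul1r big1 ?addr0 // => B BA.
      by rewrite eq_sym (negPf BA) mul0r.
    case: ifPn => [i0|i0]; last first.
      rewrite (_ : \sum_B V i B = 0) ?mulr0 ?subr0 ?mulrBl //.
      by apply: sum_ksubset_pair_sign => //; apply: contraNneq i0 => /= ->.
    have V1 B : V i B = 1 by rewrite /V (size0nil (eqP i0)) /pair_sign big_nil.
    have l0 : lev i = 0%N :> nat := eqP i0.
    (* At level 0 the vector is constant, and the all-ones term subtracts exactly [lambda 0 - m]. *)
    rewrite l0 V1 (eq_bigr (fun=> 1)) // sumr_const -[1 *+ _]/(_%:R).
    have N0 : #|ksubset n k|%:R != 0 :> rat.
      by rewrite pnatr_eq0 -lt0n; apply/card_gt0P; exists A.
    by field.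
  by move=> l _; apply: sum_ksubset_dist_ind.
- move=> j l; rewrite !eberlein_coef1 // => [e||]; try by rewrite -ltnS.
  have [jK lK] : (j <= K)%N /\ (l <= K)%N by split; rewrite -ltnS.
  (* The eigenvalues of relation 1 at j and l differ by $(l-j)(n+1-j-l)$ up to the order of
     subtraction; the second factor is nonzero because $j + l \le 2K \le n$. *)
  have : (j%:R - l%:R) * (n.+1%:R - (j + l)%:R) = 0 :> rat by rewrite natrD -natr1; lra.
  move/eqP; rewrite mulf_eq0 !subr_eq0 !eqr_nat => /orP[/eqP /val_inj //|/eqP].
  by move: jK lK; rewrite /K; lia.
- move=> i; case: ifPn => // i0; rewrite subr_ge0; apply: m_le.
  by rewrite lt0n i0 -ltnS ltn_ord.
move=> w orth A.
(* Extend [w] by zero to subsets of every size, as [pair_sign_complete] expects. *)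
pose w' (B : {set 'I_n}) := if insub B is Some A' then w A' else 0 : rat.
have w'E A' : w' (val A') = w A' by rewrite /w' valK.
rewrite -w'E; apply: (@pair_sign_complete _ k).
- by rewrite card_ord.
- by move=> B Bk; rewrite /w' insubN.
move=> s us; rewrite card_ord => sK.
have := orth (Sub (Bseq sK) us); rewrite /V SubK /= => w0; rewrite -[RHS]w0.
under [RHS]eq_bigr => A' _ do rewrite -w'E.
rewrite (sum_ksubset (fun B => w' B * pair_sign s B)) [RHS]big_mkcond.
apply: eq_bigr => B _; case: ifPn => // Bk.
by rewrite /w' insubN // mul0r.
Qed.

(** This serves both graph families: the edges need only contain the relations indexed by [S]. The
    value at j = 0 is the row sum, hence the numerator. *)
Lemma ratio_bound_johnson_scheme (e : rel (ksubset n k)) (S : pred nat) (m : int) :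
    irreflexive e ->
    (forall i A B, S i -> #|val A :\: val B| = i -> e A B) ->
    (forall j, (1 <= j <= K)%N -> m <= \sum_(0 <= i < k.+1 | S i) eberlein i j n k) ->
  1 + (\sum_(0 <= i < k.+1 | S i) 'C(k, i) * 'C(n - k, i))%N%:R / - m%:~R
    <= (chi e)%:R :> rat.
Proof.
move=> irr adj m_le.
have lambdaE j : (j <= K)%N ->
    \sum_(i < k.+1 | S i) eberlein_coef j (k - j) (n - k - j) i =
    (\sum_(0 <= i < k.+1 | S i) eberlein i j n k)%:~R.
  by move=> jK; rewrite rmorph_sum big_mkord /=; apply: eq_bigr => i _; rewrite eberleinE.
have psd := @psd_johnson_scheme S m%:~R _.
apply: (ratio_bound (M := fun A B => \sum_(i < k.+1 | S i) dist_ind i (val A) (val B))) => //.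
- have [|B _ /ksubset_of[A _]] := @exists_subset_card _ [set: 'I_n] k.
    by rewrite cardsT card_ord.
  by apply/card_gt0P; exists A.
- move=> A B nAB; rewrite big1 // => i Si; rewrite /dist_ind; case: eqP => // /adj.
  by move/(_ Si); rewrite (negPf nAB).
rewrite natr_sum big_mkord.
under eq_bigr => i _ do rewrite -eberlein_coef0.
move=> w; have := psd _ w; rewrite !subn0; apply => j jK.
by rewrite lambdaE ?ler_int ?m_le //; case/andP: jK.
Qed.

Lemma gpower_irreflexive (T : finType) (e : rel T) p : irreflexive (gpower e p).
Proof. by move=> x; rewrite /gpower eqxx. Qed.

Lemma min1_le N F j : (1 <= j <= N)%N -> min1 N F <= F j.
Proof.
move=> jN; rewrite /min1; have : j \in index_iota 1 N.+1 by rewrite mem_index_iota ltnS.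
elim: (index_iota _ _) => // i r IHr; rewrite inE big_cons ge_min.
by case/orP => [/eqP ->|/IHr ->]; rewrite ?lexx ?orbT.
Qed.

End JohnsonScheme.

(** * The bounds for Johnson and Kneser graph powers *)

Unset Implicit Arguments.

Theorem theorem4p5 (k : nat) (hk : (1 <= k)%N) :
  (forall n p : nat, (k <= n)%N -> (1 <= p <= minn k (n - k))%N ->
     1 + (\sum_(1 <= i < p.+1) 'C(k, i) * 'C(n - k, i))%N%:R
         / (- (min1 k (fun j => \sum_(1 <= i < p.+1) eberlein i j n k))%:~R)
     <= (chi (gpower (@johnson n k) p))%:R :> rat)
  /\
  (forall n p : nat, (2 * k < n)%N ->
     (1 <= p <= ceil_ratio (k - 1) (n - 2 * k) + 1)%N ->
     1 + (\sum_(0 <= i < k.+1 | (1 <= delta n k i <= p)%N)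
            'C(k, i) * 'C(n - k, i))%N%:R
         / (- (min1 k (fun j =>
                 \sum_(0 <= i < k.+1 | (1 <= delta n k i <= p)%N)
                   eberlein i j n k))%:~R)
     <= (chi (gpower (@kneser n k) p))%:R :> rat).
Proof.
split=> n p.
  move=> kn /andP[p1 pK].
  have range (R : nmodType) (F : nat -> R) :
      \sum_(1 <= i < p.+1) F i = \sum_(0 <= i < k.+1 | (1 <= i <= p)%N) F i.
    rewrite (big_nat_widen 1 p.+1 k.+1) ?(big_nat_widenl 1 0) //; last by lia.
    by apply: eq_bigl => i; rewrite ltnS andbC.
  have -> : (\sum_(1 <= i < p.+1) 'C(k, i) * 'C(n - k, i))%N =
      (\sum_(0 <= i < k.+1 | (1 <= i <= p)%N) 'C(k, i) * 'C(n - k, i))%N by exact: (range nat).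
  apply: (ratio_bound_johnson_scheme kn) => [|i A B ip AB|j jK].
  - exact: gpower_irreflexive.
  - exact: gpower_johnson AB ip.
  (* The levels run over $1 \le j \le \min(k, n-k)$, and the minimum over the possibly longer range
     up to k still bounds them below. *)
  by rewrite -range; apply: (@min1_le k (fun j => \sum_(1 <= i < p.+1) eberlein i j n k)); lia.
move=> kn _; apply: ratio_bound_johnson_scheme => [||i A B ip AB|j jK].
- by lia.
- exact: gpower_irreflexive.
- exact: gpower_kneser kn AB ip.
by apply: (@min1_le k (fun j =>
  \sum_(0 <= i < k.+1 | (1 <= delta n k i <= p)%N) eberlein i j n k)); lia.
Qed.
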